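(* Let $\mathrm{B}:2^{<\omega}\times 2^{<\omega}\to\mathbb{N}$ satisfy: (1) $\mathrm{B}(x|y)$ is upper semi-computable uniformly in $x,y$; (2) there is a constant $c$ such that $\mathrm{B}(x|y)\le |x|+c$ for all $x,y\in 2^{<\omega}$; (3) there is a constant $d$, independent of $y$, such that $|\{x : \mathrm{B}(x|y)\le n\}|\le d\cdot 2^n$ for all $y\in 2^{<\omega}$ and $n\in\mathbb{N}$; (4) there is a constant $e$ such that $\mathrm{B}(\langle x,y\rangle|y)\le \mathrm{B}(x|y)+e$ for all $x,y$; (5) for every partial computable function $f:2^{<\omega}\to 2^{<\omega}$ there is a constant $c_f$ such that $\mathrm{B}(f(x)|y)\le \mathrm{B}(x|y)+c_f$ for all $y$ and all $x$ in the domain of $f$. Then there is a constant $c'$ such that $|\mathrm{B}(x|y)-\mathrm{C}(x|y)|\le c'$ for all $x,y\in 2^{<\omega}$.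
   Context: $2^{<\omega}$ is the set of finite binary strings; $|x|$ is the length of $x$; $\langle\cdot,\cdot\rangle$ is a fixed computable pairing function on strings. For a machine $T$, the conditional complexity is $\mathrm{C}_T(x|y)=\min\{|z| : T(\langle z,y\rangle)=x\}$. Fix an optimal machine $\mathbb{U}$ (for every machine $T$ there is $c_T$ with $\mathrm{C}_{\mathbb{U}}(x|y)\le \mathrm{C}_T(x|y)+c_T$ for all $x,y$) and set $\mathrm{C}(x|y)=\mathrm{C}_{\mathbb{U}}(x|y)$. Upper semi-computable uniformly in $x,y$ means the predicate ''$\mathrm{B}(x|y)\le k$'' is computably enumerable uniformly in $x,y,k$. *)

(* Defs.v *)
(* World: plain MathComp (boot). Computability is modelled by mu-recursive
   functions on nat; finite binary strings are encoded by bijective base-2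
   numeration. *)
From mathcomp Require Import all_boot.
Set Implicit Arguments. Unset Strict Implicit. Unset Printing Implicit Defensive.

Notation str := (seq bool).

(* bijection 2^{<omega} -> nat (bijective base-2 numeration, little endian) *)
Fixpoint code (s : str) : nat :=
  match s with
  | [::] => 0
  | b :: s' => (code s').*2 + (if b then 2 else 1)
  end.

Definition spair (x y : str) : str := nseq (size x) true ++ false :: x ++ y.

Inductive rec : Type :=
| RZero : rec
| RSucc : rec
| RProj : nat -> rec
| RComp : rec -> seq rec -> rec
| RPrec : rec -> rec -> rec
| RMu   : rec -> rec.

Inductive eval : rec -> seq nat -> nat -> Prop :=
| evZero xs : eval RZero xs 0
| evSucc xs : eval RSucc xs (head 0 xs).+1
| evProj i xs : eval (RProj i) xs (nth 0 xs i)
| evComp f gs xs ys v :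
    evals gs xs ys -> eval f ys v -> eval (RComp f gs) xs v
| evPrec0 f g xs v : eval f xs v -> eval (RPrec f g) (0 :: xs) v
| evPrecS f g n xs r v :
    eval (RPrec f g) (n :: xs) r -> eval g (n :: r :: xs) v ->
    eval (RPrec f g) (n.+1 :: xs) v
| evMu f xs n :
    eval f (n :: xs) 0 ->
    (forall m, m < n -> exists v, v <> 0 /\ eval f (m :: xs) v) ->
    eval (RMu f) xs n
with evals : seq rec -> seq nat -> seq nat -> Prop :=
| evsNil xs : evals [::] xs [::]
| evsCons g gs xs v vs :
    eval g xs v -> evals gs xs vs -> evals (g :: gs) xs (v :: vs).

(* A machine / partial computable function 2^{<omega} -> 2^{<omega} is given
   by a program p; runs p x z  means  p(x) converges and equals z. *)
Definition runs (p : rec) (x z : str) : Prop := eval p [:: code x] (code z).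

Definition CT_is (T : rec) (x y : str) (k : nat) : Prop :=
  (exists z, runs T (spair z y) x /\ size z = k) /\
  (forall z, runs T (spair z y) x -> k <= size z).

Definition optimal (U : rec) : Prop :=
  forall T : rec, exists cT : nat, forall x y z,
    runs T (spair z y) x ->
    exists z', runs U (spair z' y) x /\ size z' <= size z + cT.

(* "B(x|y) <= k" is c.e. uniformly in x,y,k: it is the domain of a partial
   recursive function of (code x, code y, k). *)
Definition upper_semicomputable (B : str -> str -> nat) : Prop :=
  exists p : rec, forall x y k,
    B x y <= k <-> exists v, eval p [:: code x; code y; k] v.

(* Main.v *)
(* Lower bound: if U(<z,y>) = x then, using that B cannot grow along U, along pairing,
   and beyond the length of its argument,
   B(x|y) <= B(<z,y>|y) + O(1) <= B(z|y) + O(1) <= |z| + O(1).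
   Upper bound: for n = B(x|y), the set {x' | B(x'|y) <= n} is enumerable uniformly in
   (y, n) and has at most d 2^n <= 2^(n+d) elements, so x is determined by y and its
   rank i < 2^(n+d) in that enumeration.  A single machine recovers x from <z,y> where
   z is the i-th string of length n + d (its length tells n), so C_T(x|y) <= B(x|y) + d,
   and optimality of U finishes the proof.
   Realising the enumeration by mu-recursive programs needs a step-bounded interpreter,
   which is itself a total computable function. *)

Require Import Defs.
From mathcomp Require Import all_boot zify.
From Stdlib Require List Wf_nat Classical_Prop.
Set Implicit Arguments. Unset Strict Implicit. Unset Printing Implicit Defensive.

(** * Total computable functions on tuples of naturals *)

Definition arg i (l : seq nat) := nth 0 l i.
Arguments arg i l : simpl never.

Definition computable k (f : seq nat -> nat) :=
  exists p, forall xs, size xs = k -> eval p xs (f xs).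

Lemma computable_ext k f g :
  computable k f -> (forall xs, size xs = k -> f xs = g xs) -> computable k g.
Proof. by move=> [p Hp] fg; exists p => xs s; rewrite -fg //; apply: Hp. Qed.

Lemma computable_arg k i : computable k (arg i).
Proof. by exists (RProj i) => xs _; apply: evProj. Qed.

Lemma computable0 k : computable k (fun=> 0).
Proof. by exists RZero => xs _; apply: evZero. Qed.

Lemma computableS k f : computable k f -> computable k (fun xs => (f xs).+1).
Proof.
move=> [p Hp]; exists (RComp RSucc [:: p]) => xs s.
by apply: evComp (evSucc [:: f xs]); apply: evsCons (evsNil _); apply: Hp.
Qed.

Lemma computable_const k c : computable k (fun=> c).
Proof. by elim: c => [|c IHc]; [apply: computable0 | apply: computableS]. Qed.

Lemma evals_computable k (fs : seq (seq nat -> nat)) :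
  (forall i, i < size fs -> computable k (nth (fun=> 0) fs i)) ->
  exists ps, forall xs, size xs = k -> evals ps xs (map (fun f => f xs) fs).
Proof.
elim: fs => [|f fs IHfs] Hfs; first by exists [::] => xs _; apply: evsNil.
have [p Hp] := Hfs 0 isT.
have [ps Hps] := IHfs (fun i => Hfs i.+1).
by exists (p :: ps) => xs s; apply: evsCons; [apply: Hp | apply: Hps].
Qed.

Lemma computable_app k fs f :
  computable (size fs) f ->
  (forall i, i < size fs -> computable k (nth (fun=> 0) fs i)) ->
  computable k (fun xs => f (map (fun g => g xs) fs)).
Proof.
move=> [p Hp] /evals_computable[ps Hps].
by exists (RComp p ps) => xs s; apply: evComp (Hps _ s) _; apply: Hp; rewrite size_map.
Qed.

Lemma computable_args k idx f :
  computable (size idx) f -> computable k (fun l => f (map (arg^~ l) idx)).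
Proof.
move=> Hf; apply: computable_ext.
  apply: (@computable_app k (map arg idx) f); first by rewrite size_map.
  by move=> i; rewrite size_map => Hi; rewrite (nth_map 0) //; apply: computable_arg.
by move=> xs _ /=; rewrite -map_comp.
Qed.

Lemma map_arg_iota j k l : size l = j + k -> map (arg^~ l) (iota j k) = drop j l.
Proof.
move=> s; apply: (@eq_from_nth _ 0); first by rewrite size_map size_iota size_drop s addKn.
move=> i; rewrite size_map size_iota => Hi.
by rewrite (nth_map 0) ?size_iota // nth_iota // nth_drop.
Qed.

Lemma computable_comp1 k h f :
  computable 1 (fun l => h (arg 0 l)) -> computable k f -> computable k (fun xs => h (f xs)).
Proof. by move=> Hh Hf; apply: (@computable_app k [:: f] _ Hh); case. Qed.

Lemma computable_comp2 k h f g :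
  computable 2 (fun l => h (arg 0 l) (arg 1 l)) -> computable k f -> computable k g ->
  computable k (fun xs => h (f xs) (g xs)).
Proof. by move=> Hh Hf Hg; apply: (@computable_app k [:: f; g] _ Hh); case=> [|[]]. Qed.

Lemma computable_skip1 k f :
  computable k.+1 f -> computable k.+2 (fun l => f (arg 0 l :: drop 2 l)).
Proof.
move=> Hf; apply: computable_ext (@computable_args k.+2 (0 :: iota 2 k) f _) _.
  by rewrite /= size_iota.
by move=> l s /=; rewrite (@map_arg_iota 2 k) // s.
Qed.

Fixpoint primrec (f g : seq nat -> nat) n xs :=
  if n is m.+1 then g (m :: primrec f g m xs :: xs) else f xs.

Lemma computable_primrec_head k f g :
  computable k f -> computable k.+2 g ->
  computable k.+1 (fun l => primrec f g (head 0 l) (behead l)).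
Proof.
move=> [p Hp] [q Hq]; exists (RPrec p q) => [[|n xs]] //= [s].
elim: n => [|n IHn] /=; first by apply: evPrec0; apply: Hp.
by apply: evPrecS IHn _; apply: Hq; rewrite /= s.
Qed.

Lemma computable_primrec k f g c :
  computable k f -> computable k.+2 g -> computable k c ->
  computable k (fun xs => primrec f g (c xs) xs).
Proof.
move=> Hf Hg Hc; apply: computable_ext.
  apply: (@computable_app k (c :: map arg (iota 0 k))
            (fun l => primrec f g (head 0 l) (behead l))).
    by rewrite /= size_map size_iota; apply: computable_primrec_head.
  case=> [|i] //=; rewrite size_map size_iota => Hi.
  by rewrite (nth_map 0) ?size_iota //; apply: computable_arg.
by move=> xs s /=; rewrite -map_comp (@map_arg_iota 0 k) ?drop0.
Qed.

Lemma computable_add k f g :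
  computable k f -> computable k g -> computable k (fun xs => f xs + g xs).
Proof.
apply: computable_comp2; apply: computable_ext.
  exact: (computable_primrec (computable_arg 2 0) (computableS (computable_arg _ 1))
                              (computable_arg 2 1)).
move=> xs _ /=; elim: (arg 1 xs) => [|n IHn] /=; first by rewrite addn0.
by rewrite /arg /= IHn addnS.
Qed.

Lemma computable_mul k f g :
  computable k f -> computable k g -> computable k (fun xs => f xs * g xs).
Proof.
apply: computable_comp2; apply: computable_ext.
  exact: (computable_primrec (computable0 2)
            (computable_add (computable_arg _ 1) (computable_arg _ 3)) (computable_arg 2 0)).
by move=> xs _ /=; elim: (arg 0 xs) => [|n IHn] //=; rewrite /arg /= IHn mulSn addnC.
Qed.

Lemma computable_pred k f : computable k f -> computable k (fun xs => (f xs).-1).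
Proof.
apply: computable_comp1; apply: computable_ext.
  exact: (computable_primrec (computable0 1) (computable_arg _ 0) (computable_arg 1 0)).
by move=> xs _ /=; case: (arg 0 xs).
Qed.

Lemma computable_sub k f g :
  computable k f -> computable k g -> computable k (fun xs => f xs - g xs).
Proof.
apply: computable_comp2; apply: computable_ext.
  exact: (computable_primrec (computable_arg 2 0) (computable_pred (computable_arg _ 1))
                              (computable_arg 2 1)).
move=> xs _ /=; elim: (arg 1 xs) => [|n IHn] /=; first by rewrite subn0.
by rewrite /arg /= IHn subnS.
Qed.

Lemma computable_exp2 k f : computable k f -> computable k (fun xs => 2 ^ f xs).
Proof.
apply: (@computable_comp1 k (expn 2)); apply: computable_ext.
  exact: (computable_primrec (computable_const 1 1)
            (computable_mul (computable_arg _ 1) (computable_const _ 2)) (computable_arg 1 0)).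
by move=> xs _ /=; elim: (arg 0 xs) => [|n IHn] //=; rewrite /arg /= IHn expnS mulnC.
Qed.

Lemma computable_iter k h f c :
  computable 1 (fun l => h (arg 0 l)) -> computable k f -> computable k c ->
  computable k (fun xs => iter (c xs) h (f xs)).
Proof.
move=> Hh Hf Hc; apply: computable_ext.
  apply: (@computable_primrec k f (fun l => h (arg 1 l)) c) => //.
  by apply: computable_comp1 Hh _; apply: computable_arg.
by move=> xs _ /=; elim: (c xs) => [|n IHn] //=; rewrite /arg /= IHn.
Qed.

Lemma computable_bool k (b : seq nat -> bool) f :
  computable k f -> (forall xs, size xs = k -> b xs = (0 < f xs)) ->
  computable k (fun xs => b xs).
Proof.
move=> Hf bf.
have Hpos : computable 1 (fun l => 0 < arg 0 l).
  apply: computable_ext.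
    exact: (computable_primrec (computable0 1) (computable_const _ 1) (computable_arg 1 0)).
  by move=> xs _ /=; case: (arg 0 xs).
by apply: computable_ext (@computable_comp1 k (fun n => 0 < n) f Hpos Hf) _ => xs s; rewrite bf.
Qed.

Lemma computable_lt k f g :
  computable k f -> computable k g -> computable k (fun xs => f xs < g xs).
Proof.
by move=> Hf Hg; apply: computable_bool (computable_sub Hg Hf) _ => xs _; rewrite subn_gt0.
Qed.

Lemma computable_le k f g :
  computable k f -> computable k g -> computable k (fun xs => f xs <= g xs).
Proof.
by move=> Hf Hg; apply: computable_lt (computableS Hg).
Qed.

Lemma computable_odd k f : computable k f -> computable k (fun xs => odd (f xs)).
Proof.
apply: (@computable_comp1 k (fun n => nat_of_bool (odd n))); apply: computable_ext.
  exact: (computable_primrec (computable0 1)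
            (computable_sub (computable_const _ 1) (computable_arg _ 1)) (computable_arg 1 0)).
by move=> xs _ /=; elim: (arg 0 xs) => [|n IHn] //=; rewrite /arg /= IHn; case: (odd n).
Qed.

Lemma computable_half k f : computable k f -> computable k (fun xs => (f xs)./2).
Proof.
apply: (@computable_comp1 k half); apply: computable_ext.
  exact: (computable_primrec (computable0 1)
            (computable_add (computable_arg _ 1) (computable_odd (computable_arg _ 0)))
            (computable_arg 1 0)).
by move=> xs _ /=; elim: (arg 0 xs) => [|n IHn] //=; rewrite /arg /= IHn uphalf_half addnC.
Qed.

Lemma computable_negb k (b : seq nat -> bool) :
  computable k (fun xs => b xs) -> computable k (fun xs => ~~ b xs).
Proof.
move=> Hb; apply: computable_ext (computable_sub (computable_const k 1) Hb) _.
by move=> xs _ /=; case: (b xs).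
Qed.

Lemma computable_andb k (b c : seq nat -> bool) :
  computable k (fun xs => b xs) -> computable k (fun xs => c xs) ->
  computable k (fun xs => b xs && c xs).
Proof.
move=> Hb Hc; apply: computable_ext (computable_mul Hb Hc) _.
by move=> xs _ /=; case: (b xs); case: (c xs).
Qed.

Lemma computable_eq k f g :
  computable k f -> computable k g -> computable k (fun xs => f xs == g xs).
Proof.
move=> Hf Hg; apply: computable_ext (computable_andb (computable_le Hf Hg) (computable_le Hg Hf)) _.
by move=> xs _; rewrite eqn_leq.
Qed.

Lemma computable_if k (b : seq nat -> bool) f g :
  computable k (fun xs => b xs) -> computable k f -> computable k g ->
  computable k (fun xs => if b xs then f xs else g xs).
Proof.
move=> Hb Hf Hg; have Hnb := computable_negb Hb.
apply: computable_ext (computable_add (computable_mul Hb Hf) (computable_mul Hnb Hg)) _.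
by move=> xs _ /=; case: (b xs); rewrite /= ?mul1n ?mul0n ?addn0.
Qed.

Lemma computable_sum k f c :
  computable k.+1 f -> computable k c ->
  computable k (fun xs => \sum_(0 <= m < c xs) f (m :: xs)).
Proof.
move=> Hf Hc; apply: computable_ext.
  apply: (@computable_primrec k (fun=> 0) (fun l => arg 1 l + f (arg 0 l :: drop 2 l)) c) => //.
    exact: computable0.
  by apply: computable_add; [apply: computable_arg | apply: computable_skip1].
move=> xs _ /=; elim: (c xs) => [|n IHn] /=; first by rewrite big_geq.
by rewrite big_nat_recr //= /arg /= drop0 IHn.
Qed.

Lemma find_iota0S (a : pred nat) n :
  find a (iota 0 n.+1) =
    if find a (iota 0 n) < n then find a (iota 0 n) else if a n then n else n.+1.
Proof.
rewrite -addn1 iotaD find_cat /= size_iota has_find size_iota.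
by case: ifP => // _; rewrite add0n; case: (a n); rewrite ?addn0.
Qed.

Lemma computable_find k (a : seq nat -> bool) c :
  computable k.+1 (fun xs => a xs) -> computable k c ->
  computable k (fun xs => find (fun m => a (m :: xs)) (iota 0 (c xs))).
Proof.
move=> Ha Hc; apply: computable_ext.
  apply: (@computable_primrec k (fun=> 0) (fun l =>
      if arg 1 l < arg 0 l then arg 1 l
      else if a (arg 0 l :: drop 2 l) then arg 0 l else (arg 0 l).+1) c) => //.
    exact: computable0.
  apply: computable_if; first by apply: computable_lt; apply: computable_arg.
    exact: computable_arg.
  apply: computable_if; first exact: (computable_skip1 Ha).
    exact: computable_arg.
  by apply: computableS; apply: computable_arg.
move=> xs _ /=; elim: (c xs) => [|n IHn] //.
by rewrite find_iota0S -IHn /= /arg /= drop0.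
Qed.

(** * Evaluation with fuel *)

Fixpoint eval_fuel (t : nat) (p : rec) (xs : seq nat) {struct p} : option nat :=
  match p with
  | RZero => Some 0
  | RSucc => Some (head 0 xs).+1
  | RProj i => Some (nth 0 xs i)
  | RComp f gs =>
      let fix evals_gs gs :=
        if gs is g :: gs' then
          if eval_fuel t g xs is Some v then
            if evals_gs gs' is Some vs then Some (v :: vs) else None
          else None
        else Some [::] in
      if evals_gs gs is Some vs then eval_fuel t f vs else None
  | RPrec f g =>
      if xs is n :: xs' then
        let fix prec n :=
          if n is m.+1 then
            if prec m is Some r then eval_fuel t g (m :: r :: xs') else None
          else eval_fuel t f xs' in
        prec n
      else None
  | RMu f =>
      let m := find (fun m => if eval_fuel t f (m :: xs) is Some _.+1 then false else true)
                    (iota 0 t) in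
      if (m < t) && (eval_fuel t f (m :: xs) == Some 0) then Some m else None
  end.

Fixpoint evals_fuel t gs xs : option (seq nat) :=
  if gs is g :: gs' then
    if eval_fuel t g xs is Some v then
      if evals_fuel t gs' xs is Some vs then Some (v :: vs) else None
    else None
  else Some [::].

Fixpoint prec_fuel t f g n xs :=
  if n is m.+1 then
    if prec_fuel t f g m xs is Some r then eval_fuel t g (m :: r :: xs) else None
  else eval_fuel t f xs.

Definition mu_fuel_test t f xs m :=
  if eval_fuel t f (m :: xs) is Some _.+1 then false else true.

Lemma eval_fuel_comp t f gs xs :
  eval_fuel t (RComp f gs) xs =
  if evals_fuel t gs xs is Some vs then eval_fuel t f vs else None.
Proof. by rewrite /=; congr (if _ is Some vs then _ else _); elim: gs => //= g gs ->. Qed.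

Lemma eval_fuel_prec t f g n xs : eval_fuel t (RPrec f g) (n :: xs) = prec_fuel t f g n xs.
Proof. by elim: n => //= n ->. Qed.

Lemma eval_fuel_mu t f xs :
  eval_fuel t (RMu f) xs =
  let m := find (mu_fuel_test t f xs) (iota 0 t) in
  if (m < t) && (eval_fuel t f (m :: xs) == Some 0) then Some m else None.
Proof. by []. Qed.

Lemma evals_fuelE t gs xs :
  evals_fuel t gs xs =
  if all (fun g => eval_fuel t g xs != None) gs
  then Some (map (fun g => odflt 0 (eval_fuel t g xs)) gs) else None.
Proof. by elim: gs => //= g gs ->; case: (eval_fuel t g xs) => [v|] //=; case: all. Qed.

Section RecNestedInd.
Variable P : rec -> Prop.
Hypothesis P_zero : P RZero.
Hypothesis P_succ : P RSucc.
Hypothesis P_proj : forall i, P (RProj i).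
Hypothesis P_comp : forall f gs, P f -> List.Forall P gs -> P (RComp f gs).
Hypothesis P_prec : forall f g, P f -> P g -> P (RPrec f g).
Hypothesis P_mu : forall f, P f -> P (RMu f).

Fixpoint rec_nested_ind (p : rec) : P p :=
  match p with
  | RZero => P_zero
  | RSucc => P_succ
  | RProj i => P_proj i
  | RComp f gs =>
      P_comp (rec_nested_ind f)
        ((fix all_gs gs : List.Forall P gs :=
            if gs is g :: gs' then List.Forall_cons g (rec_nested_ind g) (all_gs gs')
            else List.Forall_nil P) gs)
  | RPrec f g => P_prec (rec_nested_ind f) (rec_nested_ind g)
  | RMu f => P_mu (rec_nested_ind f)
  end.
End RecNestedInd.

Lemma Forall_nth (T : Type) (P : T -> Prop) x0 s i :
  List.Forall P s -> i < size s -> P (nth x0 s i).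
Proof. by move=> Hs; elim: Hs i => [|x s' Px _ IHs] [|i] //=; apply: IHs. Qed.

Lemma find_iota0_eq (a : pred nat) n m :
  m < n -> a m -> (forall j, j < m -> ~~ a j) -> find a (iota 0 n) = m.
Proof.
move=> mn am before_m.
have has_a : has a (iota 0 n) by apply/hasP; exists m; rewrite ?mem_iota.
have := has_a; rewrite has_find size_iota => lt_find.
have := nth_find 0 has_a; rewrite nth_iota // add0n => a_find.
case: (ltngtP (find a (iota 0 n)) m) => // lt.
  by have := before_m _ lt; rewrite a_find.
by have := before_find 0 lt; rewrite nth_iota ?am // (ltn_trans lt lt_find).
Qed.

Lemma eval_fuel_sound p t xs v : eval_fuel t p xs = Some v -> eval p xs v.
Proof.
elim/rec_nested_ind: p t xs v.
- by move=> t xs v [<-]; apply: evZero.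
- by move=> t xs v [<-]; apply: evSucc.
- by move=> i t xs v [<-]; apply: evProj.
- move=> f gs IHf IHgs t xs v; rewrite eval_fuel_comp.
  case E: (evals_fuel t gs xs) => [vs|] // /IHf Hf.
  apply: evComp Hf; elim: IHgs vs E => [|g gs' IHg _ IH] vs /=.
    by move=> [<-]; apply: evsNil.
  case Eg: (eval_fuel t g xs) => [w|] //; case Es: (evals_fuel t gs' xs) => [ws|] // [<-].
  by apply: evsCons; [apply: IHg Eg | apply: IH].
- move=> f g IHf IHg t [|n xs] v //; rewrite eval_fuel_prec.
  elim: n v => [|n IHn] v /=; first by move/IHf; apply: evPrec0.
  by case E: (prec_fuel t f g n xs) => [r|] // /IHg; apply: evPrecS (IHn _ E).
- move=> f IHf t xs v; rewrite eval_fuel_mu /=.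
  set m := find _ _; case: ifP => // /andP[lt_mt /eqP Em] [<-].
  apply: evMu; first exact: IHf Em.
  move=> j lt_jm; have := before_find 0 lt_jm.
  rewrite nth_iota ?(ltn_trans lt_jm lt_mt) // add0n /mu_fuel_test.
  case Ej: (eval_fuel t f (j :: xs)) => [[|w]|] //= _.
  by exists w.+1; split => //; apply: IHf Ej.
Qed.

Lemma eval_fuel_mono p t t' xs v :
  t <= t' -> eval_fuel t p xs = Some v -> eval_fuel t' p xs = Some v.
Proof.
move=> le_tt'; elim/rec_nested_ind: p xs v => //.
- move=> f gs IHf IHgs xs v; rewrite !eval_fuel_comp.
  case E: (evals_fuel t gs xs) => [vs|] // /IHf Hf.
  suff -> : evals_fuel t' gs xs = Some vs by [].
  elim: IHgs vs E {Hf} => [|g gs' IHg _ IH] vs //=.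
  case Eg: (eval_fuel t g xs) => [w|] //; case Es: (evals_fuel t gs' xs) => [ws|] // [<-].
  by rewrite (IHg _ _ Eg) (IH _ Es).
- move=> f g IHf IHg [|n xs] v //; rewrite !eval_fuel_prec.
  elim: n v => [|n IHn] v /=; first exact: IHf.
  by case E: (prec_fuel t f g n xs) => [r|] //; rewrite (IHn _ E); apply: IHg.
- move=> f IHf xs v; rewrite !eval_fuel_mu /=.
  set m := find _ _; case: ifP => // /andP[lt_mt /eqP Em] [<-].
  have Em' := IHf _ _ Em.
  have -> : find (mu_fuel_test t' f xs) (iota 0 t') = m.
    apply: find_iota0_eq; first exact: leq_trans lt_mt le_tt'.
      by rewrite /mu_fuel_test Em'.
    move=> j lt_jm; have := before_find 0 lt_jm.
    rewrite nth_iota ?(ltn_trans lt_jm lt_mt) // add0n /mu_fuel_test.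
    by case Ej: (eval_fuel t f (j :: xs)) => [[|w]|] //= _; rewrite (IHf _ _ Ej).
  by rewrite (leq_trans lt_mt le_tt') Em' eqxx.
Qed.

Lemma evals_fuel_mono gs t t' xs vs :
  t <= t' -> evals_fuel t gs xs = Some vs -> evals_fuel t' gs xs = Some vs.
Proof.
move=> le_tt'; elim: gs vs => [|g gs IHgs] vs //=.
case Eg: (eval_fuel t g xs) => [w|] //; case Es: (evals_fuel t gs xs) => [ws|] // [<-].
by rewrite (eval_fuel_mono le_tt' Eg) (IHgs _ Es).
Qed.

Lemma ex_uniform_bound (Q : nat -> nat -> Prop) n :
  (forall m t t', t <= t' -> Q m t -> Q m t') ->
  (forall m, m < n -> exists t, Q m t) -> exists t, forall m, m < n -> Q m t.
Proof.
move=> Q_mono; elim: n => [|n IHn] Hn; first by exists 0.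
have [t Ht] := IHn (fun m lt_mn => Hn m (ltnW lt_mn)).
have [tn Htn] := Hn n (ltnSn n).
exists (maxn t tn) => m; rewrite ltnS leq_eqVlt => /orP[/eqP -> | lt_mn].
  by apply: Q_mono Htn; apply: leq_maxr.
by apply: Q_mono (Ht m lt_mn); apply: leq_maxl.
Qed.

Lemma eval_fuel_mu_complete f xs n t0 :
  eval_fuel t0 f (n :: xs) = Some 0 ->
  (forall m, m < n -> exists t w, w <> 0 /\ eval_fuel t f (m :: xs) = Some w) ->
  exists t, eval_fuel t (RMu f) xs = Some n.
Proof.
move=> Ht0 Hlt.
have [tb Htb] : exists tb, forall m, m < n ->
    exists w, w <> 0 /\ eval_fuel tb f (m :: xs) = Some w.
  apply: ex_uniform_bound Hlt => m t t' le_tt' [w [w0 Ew]].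
  by exists w; split => //; apply: eval_fuel_mono Ew.
pose t := maxn (maxn t0 tb) n.+1.
have Et0 := eval_fuel_mono (leq_trans (leq_maxl t0 tb) (leq_maxl _ n.+1)) Ht0.
have le_tb : tb <= t by rewrite /t !leq_max leqnn orbT.
have lt_nt : n < t by rewrite /t leq_max leqnn orbT.
exists t; rewrite eval_fuel_mu /=.
have -> : find (mu_fuel_test t f xs) (iota 0 t) = n.
  apply: find_iota0_eq => //; first by rewrite /mu_fuel_test Et0.
  move=> j lt_jn; have [w [w0 Ew]] := Htb j lt_jn.
  by rewrite /mu_fuel_test (eval_fuel_mono le_tb Ew); case: w w0 {Ew}.
by rewrite lt_nt Et0 eqxx.
Qed.

Fixpoint eval_fuel_complete p xs v (H : eval p xs v) {struct H} :
  exists t, eval_fuel t p xs = Some v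
with evals_fuel_complete gs xs vs (H : evals gs xs vs) {struct H} :
  exists t, evals_fuel t gs xs = Some vs.
Proof.
- case: H => {p xs v}.
  + by move=> xs; exists 0.
  + by move=> xs; exists 0.
  + by move=> i xs; exists 0.
  + move=> f gs xs ys v Hgs Hf.
    have [t1 H1] := evals_fuel_complete _ _ _ Hgs.
    have [t2 H2] := eval_fuel_complete _ _ _ Hf.
    exists (maxn t1 t2); rewrite eval_fuel_comp (evals_fuel_mono (leq_maxl t1 t2) H1).
    exact: eval_fuel_mono (leq_maxr t1 t2) H2.
  + move=> f g xs v Hf; have [t Ht] := eval_fuel_complete _ _ _ Hf.
    by exists t; rewrite eval_fuel_prec.
  + move=> f g n xs r v Hr Hg.
    have [t1 H1] := eval_fuel_complete _ _ _ Hr.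
    have [t2 H2] := eval_fuel_complete _ _ _ Hg.
    exists (maxn t1 t2); rewrite eval_fuel_prec /=.
    move: (eval_fuel_mono (leq_maxl t1 t2) H1); rewrite eval_fuel_prec => ->.
    exact: eval_fuel_mono (leq_maxr t1 t2) H2.
  + move=> f xs n Hn Hlt.
    have [t0 Ht0] := eval_fuel_complete _ _ _ Hn.
    have Hlt_fuel m : m < n -> exists t w, w <> 0 /\ eval_fuel t f (m :: xs) = Some w.
      by move=> lt_mn; case: (Hlt m lt_mn) => w [w0 /eval_fuel_complete[t Ht]]; exists t, w.
    exact: eval_fuel_mu_complete Ht0 Hlt_fuel.
- case: H => {gs xs vs}.
  + by move=> xs; exists 0.
  + move=> g gs xs v vs Hg Hgs.
    have [t1 H1] := eval_fuel_complete _ _ _ Hg.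
    have [t2 H2] := evals_fuel_complete _ _ _ Hgs.
    exists (maxn t1 t2) => /=.
    by rewrite (eval_fuel_mono (leq_maxl t1 t2) H1) (evals_fuel_mono (leq_maxr t1 t2) H2).
Qed.

(** * Clocked simulation is computable *)

Definition clocked p (l : seq nat) :=
  if eval_fuel (head 0 l) p (behead l) is Some v then v.+1 else 0.

Definition clocked_computable p := forall k, computable k.+1 (clocked p).

Lemma clocked_computable_comp f gs :
  clocked_computable f -> List.Forall clocked_computable gs ->
  clocked_computable (RComp f gs).
Proof.
move=> Hf Hgs k.
have Hall : computable k.+1 (fun l => all (fun g => 0 < clocked g l) gs).
  elim: Hgs {Hf} => [|g gs' Hg _ IH]; first exact: computable_const.
  exact: computable_andb (computable_lt (computable0 _) (Hg k)) IH.
have Hsub : computable k.+1 (fun l =>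
    clocked f (arg 0 l :: map (fun g => (clocked g l).-1) gs)).
  apply: computable_ext.
    apply: (@computable_app k.+1 (arg 0 :: map (fun g l => (clocked g l).-1) gs)).
      by rewrite /= size_map; apply: Hf.
    case=> [|i] /=; first by move=> _; apply: computable_arg.
    rewrite size_map => Hi; rewrite (nth_map RZero) //.
    exact: computable_pred (Forall_nth _ Hgs Hi k).
  by move=> xs _ /=; rewrite -map_comp.
apply: computable_ext (computable_if Hall Hsub (computable0 _)) _ => -[|t xs] // _.
rewrite /clocked /= -/(eval_fuel t (RComp f gs) xs) eval_fuel_comp evals_fuelE.
have -> : all (fun g => 0 < clocked g (t :: xs)) gs = all (fun g => eval_fuel t g xs != None) gs.
  by apply: eq_all => g; rewrite /clocked /=; case: (eval_fuel t g xs).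
case: ifP => // _; rewrite /arg /=.
by congr (if eval_fuel t f _ is Some v then _ else _); apply: eq_map => g; rewrite /clocked /=;
   case: (eval_fuel t g xs).
Qed.

Lemma clocked_computable_prec f g :
  clocked_computable f -> clocked_computable g -> clocked_computable (RPrec f g).
Proof.
move=> Hf Hg [|k].
  by apply: computable_ext (computable0 _) _ => -[|t []].
pose step l := if 0 < arg 1 l
  then clocked g (arg 2 l :: arg 0 l :: (arg 1 l).-1 :: drop 3 l) else 0.
have Hstep : computable k.+3 step.
  apply: computable_if; first exact: computable_lt (computable0 _) (computable_arg _ 1).
    apply: computable_ext.
      apply: (@computable_app k.+3
        [:: arg 2, arg 0, (fun l => (arg 1 l).-1) & map arg (iota 3 k)] (clocked g)).
        by rewrite /= size_map size_iota; apply: Hg.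
      case=> [|[|[|i]]] /=; try by move=> _; apply: computable_arg.
        by move=> _; apply: computable_pred (computable_arg _ 1).
      rewrite size_map size_iota => Hi; rewrite (nth_map 0) ?size_iota //.
      exact: computable_arg.
    by move=> l s /=; rewrite -map_comp (@map_arg_iota 3 k) // s.
  exact: computable0.
have Hrec := computable_primrec_head (Hf k) Hstep.
have := @computable_args k.+2 (1 :: 0 :: iota 2 k) _; rewrite /= size_iota => /(_ _ Hrec) H.
apply: computable_ext H _ => -[|t [|n xs]] // [s].
rewrite /clocked /= -/(eval_fuel t (RPrec f g) (n :: xs)) eval_fuel_prec.
rewrite (@map_arg_iota 2 k [:: t, n & xs]) /arg /=; last by rewrite s.
rewrite drop0; elim: n => [|n IHn] //=.
rewrite IHn /step /arg /=.
by case: (prec_fuel t f g n xs) => [r|] //=; rewrite drop0.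
Qed.

Lemma clocked_computable_mu f : clocked_computable f -> clocked_computable (RMu f).
Proof.
move=> Hf k.
pose halts l := clocked f (arg 1 l :: arg 0 l :: drop 2 l) < 2.
have Hhalts : computable k.+2 halts.
  apply: computable_lt (computable_const _ 2).
  apply: computable_ext.
    by apply: (@computable_args k.+2 (1 :: 0 :: iota 2 k) (clocked f)); rewrite /= size_iota.
  by move=> l s /=; rewrite (@map_arg_iota 2 k l) // s.
have Hfind := @computable_find k.+1 halts (arg 0) Hhalts (computable_arg _ 0).
set m := fun l => find _ _ in Hfind.
have Hfm : computable k.+1 (fun l => clocked f (arg 0 l :: m l :: drop 1 l)).
  apply: computable_ext.
    apply: (@computable_app k.+1 [:: arg 0, m & map arg (iota 1 k)] (clocked f)).
      by rewrite /= size_map size_iota; apply: Hf.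
    case=> [|[|i]] /=; try by move=> _; first [apply: computable_arg | apply: Hfind].
    rewrite size_map size_iota => Hi; rewrite (nth_map 0) ?size_iota //.
    exact: computable_arg.
  by move=> l s /=; rewrite -map_comp (@map_arg_iota 1 k l) // s.
have Hres := computable_if
  (computable_andb (computable_lt Hfind (computable_arg _ 0))
                   (computable_eq Hfm (computable_const _ 1)))
  (computableS Hfind) (computable0 _).
apply: computable_ext Hres _ => -[|t xs] // _.
rewrite /clocked /= -/(eval_fuel t (RMu f) xs) eval_fuel_mu /=.
have -> : find (mu_fuel_test t f xs) (iota 0 t) = m (t :: xs).
  rewrite /m /arg /=; apply: eq_find => j; rewrite /halts /clocked /arg /= drop0 /mu_fuel_test.
  by case: (eval_fuel t f (j :: xs)) => [[|[|w]]|].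
rewrite /arg /= drop0 /clocked /=.
case: (m (t :: xs) < t) => //=.
by case: (eval_fuel t f (m (t :: xs) :: xs)) => [[|w]|].
Qed.

Lemma clocked_computable_all p : clocked_computable p.
Proof.
elim/rec_nested_ind: p.
- by move=> k; apply: computable_ext (computable_const _ 1) _ => -[].
- by move=> k; apply: computable_ext (computableS (computableS (computable_arg _ 1))) _ => -[].
- by move=> i k; apply: computable_ext (computableS (computable_arg _ i.+1)) _ => -[].
- exact: clocked_computable_comp.
- exact: clocked_computable_prec.
- exact: clocked_computable_mu.
Qed.

(** * Coding of strings and of pairs *)

Lemma code_cat s1 s2 : code (s1 ++ s2) = code s1 + 2 ^ size s1 * code s2.
Proof. by elim: s1 => [|b s1 IHs] /=; [rewrite mul1n | rewrite IHs expnS; lia]. Qed.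

Lemma code_bounds s : 2 ^ size s <= (code s).+1 < 2 ^ (size s).+1.
Proof.
elim: s => [|b s IHs] //=; move: IHs; rewrite !expnS; set a := 2 ^ size s.
by case: b; lia.
Qed.

Lemma size_le_code s : size s <= code s.
Proof. by elim: s => [|[] s IHs] //=; lia. Qed.

Lemma size_code_eq s L : 2 ^ L <= (code s).+1 < 2 ^ L.+1 -> size s = L.
Proof.
move=> /andP[lb ub]; have /andP[lbs ubs] := code_bounds s.
case: (ltngtP (size s) L) => // lt.
  have : 2 ^ (size s).+1 <= 2 ^ L by rewrite leq_exp2l.
  lia.
have : 2 ^ L.+1 <= 2 ^ size s by rewrite leq_exp2l.
lia.
Qed.

Definition code_tail n := (n.-1)./2.
Definition code_head n := (0 < n) && ~~ odd n.

Lemma code_tail_cons b s : code_tail (code (b :: s)) = code s.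
Proof. by rewrite /code_tail /=; case: b; rewrite ?addn2 ?addn1 /= ?uphalf_double ?doubleK. Qed.

Lemma code_head_cons b s : code_head (code (b :: s)) = b.
Proof. by rewrite /code_head /=; case: b; rewrite ?addn2 ?addn1 /= ?odd_double. Qed.

Lemma iter_code_tail k s : iter k code_tail (code s) = code (drop k s).
Proof.
elim: k s => [|k IHk] s; first by rewrite drop0.
rewrite iterSr; case: s => [|b s] /=; last by rewrite code_tail_cons IHk.
by elim: k {IHk} => //= k ->.
Qed.

Lemma code_head_drop k s : code_head (code (drop k s)) = nth false s k.
Proof. by elim: k s => [|k IHk] [|b s] //=; rewrite code_head_cons. Qed.

Fixpoint decode_fuel (f n : nat) : str :=
  if f is f'.+1 then
    if n is 0 then [::] else ~~ odd n :: decode_fuel f' (code_tail n)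
  else [::].

Lemma code_decode_fuel f n : n <= f -> code (decode_fuel f n) = n.
Proof.
elim: f n => [|f IHf] [|n] //= le_nf.
rewrite IHf; last by rewrite /code_tail /= leq_half_double; lia.
rewrite /code_tail /= negbK -{3}(odd_double_half n).
by case: (odd n) => /=; lia.
Qed.

Definition decode n := decode_fuel n n.

Lemma decodeK : cancel decode code.
Proof. by move=> n; apply: code_decode_fuel. Qed.

(* The code [w] of [spair z y] starts with [size z] true bits followed by a false
   bit, then come [z] and [y]. *)
Definition pair_len w := find (fun k => ~~ code_head (iter k code_tail w)) (iota 0 w).
Definition pair_snd w := iter (pair_len w + pair_len w).+1 code_tail w.
Definition pair_fst w := iter (pair_len w).+1 code_tail w - 2 ^ pair_len w * pair_snd w.

Lemma pair_len_spair z y : pair_len (code (spair z y)) = size z.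
Proof.
rewrite /pair_len; apply: find_iota0_eq.
- by have := size_le_code (spair z y); rewrite /spair size_cat size_nseq /=; lia.
- by rewrite iter_code_tail code_head_drop /spair nth_cat size_nseq ltnn subnn.
- move=> j lt_jz; rewrite iter_code_tail code_head_drop /spair nth_cat size_nseq lt_jz.
  by rewrite nth_nseq lt_jz.
Qed.

Lemma pair_snd_spair z y : pair_snd (code (spair z y)) = code y.
Proof.
rewrite /pair_snd pair_len_spair iter_code_tail /spair drop_cat size_nseq.
have -> : (size z + size z).+1 < size z = false by lia.
have -> : (size z + size z).+1 - size z = (size z).+1 by lia.
by rewrite /= drop_size_cat.
Qed.

Lemma pair_fst_spair z y : pair_fst (code (spair z y)) = code z.
Proof.
rewrite /pair_fst pair_snd_spair pair_len_spair iter_code_tail /spair drop_cat size_nseq.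
by rewrite ltnNge leqnSn /= subSn // subnn /= drop0 code_cat; lia.
Qed.

Lemma computable_code_tail k f : computable k f -> computable k (fun xs => code_tail (f xs)).
Proof. by move=> Hf; apply: computable_half (computable_pred Hf). Qed.

Lemma computable_pair_len k f : computable k f -> computable k (fun xs => pair_len (f xs)).
Proof.
apply: (@computable_comp1 k pair_len).
have Hhead : computable 2 (fun l => code_head (iter (arg 0 l) code_tail (arg 1 l))).
  have Hiter := computable_iter (computable_code_tail (computable_arg 1 0))
                  (computable_arg 2 1) (computable_arg 2 0).
  exact: computable_andb (computable_lt (computable0 _) Hiter)
                         (computable_negb (computable_odd Hiter)).
exact: computable_find (computable_negb Hhead) (computable_arg 1 0).
Qed.

Lemma computable_pair_snd k f : computable k f -> computable k (fun xs => pair_snd (f xs)).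
Proof.
move=> Hf; have Hlen := computable_pair_len Hf.
exact: computable_iter (computable_code_tail (computable_arg _ 0)) Hf
                       (computableS (computable_add Hlen Hlen)).
Qed.

Lemma computable_pair_fst k f : computable k f -> computable k (fun xs => pair_fst (f xs)).
Proof.
move=> Hf; apply: computable_sub.
  exact: computable_iter (computable_code_tail (computable_arg _ 0)) Hf
                         (computableS (computable_pair_len Hf)).
exact: computable_mul (computable_exp2 (computable_pair_len Hf)) (computable_pair_snd Hf).
Qed.

(* The index of [z] among the strings of length [size z]. *)
Definition pair_index w := pair_fst w - (2 ^ pair_len w).-1.

Lemma pair_index_spair z y : pair_index (code (spair z y)) = code z - (2 ^ size z).-1.
Proof. by rewrite /pair_index pair_fst_spair pair_len_spair. Qed.

Lemma computable_pair_index k f : computable k f -> computable k (fun xs => pair_index (f xs)).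
Proof.
move=> Hf; apply: computable_sub (computable_pair_fst Hf) _.
exact: computable_pred (computable_exp2 (computable_pair_len Hf)).
Qed.

Lemma decode_index L i : i < 2 ^ L ->
  size (decode ((2 ^ L).-1 + i)) = L /\ code (decode ((2 ^ L).-1 + i)) - (2 ^ L).-1 = i.
Proof.
move=> lt_i; rewrite decodeK addKn; split => //.
have pos : 0 < 2 ^ L by rewrite expn_gt0.
by apply: size_code_eq; rewrite decodeK expnS; lia.
Qed.

(** * Ranks in a stagewise enumeration *)

Section Enumeration.
Variable listed : nat -> nat -> bool.
Hypothesis listed_mono : forall x t t', t <= t' -> listed x t -> listed x t'.
Hypothesis listed_lt : forall x t, listed x t -> x < t.

Definition num_listed t := \sum_(0 <= x < t) listed x t.
Definition fresh x t := listed x t && ~~ listed x t.-1.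
(* Elements are ranked by the stage at which they appear, ties broken by size. *)
Definition rank x t := num_listed t.-1 + \sum_(0 <= x' < x) fresh x' t.

Lemma num_listed_mono t t' : t <= t' -> num_listed t <= num_listed t'.
Proof.
move=> le_tt'; rewrite /num_listed (@big_cat_nat _ _ _ t 0 t') //=.
apply: leq_trans (leq_addr _ _); apply: leq_sum => x _.
by case E: (listed x t); rewrite // (listed_mono le_tt' E).
Qed.

Lemma num_listed_fresh t : num_listed t = num_listed t.-1 + \sum_(0 <= x < t) fresh x t.
Proof.
case: t => [|t]; first by rewrite /num_listed !big_geq.
rewrite /num_listed /=.
have -> : \sum_(0 <= x < t) listed x t = \sum_(0 <= x < t.+1) listed x t.
  have Ntt : listed t t = false by apply/negP => /listed_lt; rewrite ltnn.
  by rewrite big_nat_recr //= Ntt addn0.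
rewrite -big_split; apply: eq_bigr => x _; rewrite /fresh /=.
by case E: (listed x t); rewrite ?(listed_mono (leqnSn t) E) ?andbT.
Qed.

Lemma sum_fresh_lt x x' t :
  x < x' -> fresh x t -> \sum_(0 <= i < x) fresh i t < \sum_(0 <= i < x') fresh i t.
Proof.
move=> lt_xx' Fx; rewrite (@big_cat_nat _ _ _ x.+1 0 x') //= big_nat_recr //= Fx.
by rewrite addn1 ltnS leq_addr.
Qed.

Lemma rank_lt_num x t : fresh x t -> rank x t < num_listed t.
Proof.
move=> Fx; rewrite /rank [num_listed t]num_listed_fresh ltn_add2l sum_fresh_lt //.
by case/andP: Fx => /listed_lt.
Qed.

Lemma rank_inj x t x' t' : fresh x t -> fresh x' t' -> rank x t = rank x' t' -> x = x' /\ t = t'.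
Proof.
have later u v y y' : u < v -> fresh y u -> rank y u < rank y' v.
  move=> lt_uv Fy; apply: leq_trans (rank_lt_num Fy) _; rewrite /rank.
  by apply: leq_trans (leq_addr _ _); apply: num_listed_mono; case: v lt_uv.
have smaller u y y' : y < y' -> fresh y u -> rank y u < rank y' u.
  by move=> lt_yy' Fy; rewrite /rank ltn_add2l sum_fresh_lt.
move=> Fx Fx' E; case: (ltngtP t t') => [lt|lt|eq_tt']; last subst t'.
- by have := later _ _ _ x' lt Fx; rewrite E ltnn.
- by have := later _ _ _ x lt Fx'; rewrite E ltnn.
- case: (ltngtP x x') => [lt|lt|//].
  + by have := smaller _ _ _ lt Fx; rewrite E ltnn.
  + by have := smaller _ _ _ lt Fx'; rewrite E ltnn.
Qed.

Definition find_rank i t := find (fun x => fresh x t && (rank x t == i)) (iota 0 t).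

Lemma find_rank_lt x t : fresh x t -> find_rank (rank x t) t < t.
Proof.
move=> Fx; rewrite /find_rank -[t in _ < t](size_iota 0) -has_find.
by apply/hasP; exists x; rewrite ?mem_iota ?Fx ?eqxx //; case/andP: Fx => /listed_lt.
Qed.

Lemma find_rank_eq x t t' :
  fresh x t -> find_rank (rank x t) t' < t' -> find_rank (rank x t) t' = x /\ t' = t.
Proof.
move=> Fx lt_found.
have has_rank : has (fun x' => fresh x' t' && (rank x' t' == rank x t)) (iota 0 t').
  by rewrite has_find size_iota.
have := nth_find 0 has_rank; rewrite -/(find_rank _ _) nth_iota // add0n.
by case/andP => Fx' /eqP /(rank_inj Fx' Fx).
Qed.
End Enumeration.

Section ComputableRank.
Variable listed : nat -> nat -> nat -> bool.
Hypothesis listed_computable : computable 3 (fun l => listed (arg 2 l) (arg 0 l) (arg 1 l)).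

Lemma computable_num_listed : computable 2 (fun l => num_listed (listed (arg 1 l)) (arg 0 l)).
Proof. exact: computable_sum listed_computable (computable_arg _ 0). Qed.

Lemma computable_fresh : computable 3 (fun l => fresh (listed (arg 2 l)) (arg 0 l) (arg 1 l)).
Proof.
apply: computable_andb listed_computable (computable_negb _).
apply: (@computable_app 3 [:: arg 0; fun l => (arg 1 l).-1; arg 2] _ listed_computable).
by case=> [|[|[|i]]] //= _; [apply: computable_arg | apply: computable_pred (computable_arg _ 1)
                             | apply: computable_arg].
Qed.

Lemma computable_rank : computable 3 (fun l => rank (listed (arg 2 l)) (arg 0 l) (arg 1 l)).
Proof.
apply: computable_add.
  apply: (@computable_app 3 [:: fun l => (arg 1 l).-1; arg 2] _ computable_num_listed).
  by case=> [|[|i]] //= _; [apply: computable_pred (computable_arg _ 1) | apply: computable_arg].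
have Hfresh : computable 4 (fun l => fresh (listed (arg 3 l)) (arg 0 l) (arg 2 l)).
  exact: @computable_args 4 [:: 0; 2; 3] _ computable_fresh.
exact: computable_sum Hfresh (computable_arg _ 0).
Qed.

Lemma computable_find_rank (i : nat -> nat) :
  computable 1 (fun l => i (arg 0 l)) ->
  computable 2 (fun l => find_rank (listed (arg 1 l)) (i (arg 1 l)) (arg 0 l)).
Proof.
move=> Hi; have Hi2 := computable_comp1 Hi (computable_arg 3 2).
exact: computable_find (computable_andb computable_fresh (computable_eq computable_rank Hi2))
                       (computable_arg _ 0).
Qed.
End ComputableRank.

Lemma eval_at_least (P : nat -> nat -> bool) (g : nat -> nat -> nat) :
  computable 2 (fun l => P (arg 0 l) (arg 1 l)) -> computable 2 (fun l => g (arg 0 l) (arg 1 l)) ->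
  exists q, forall w t, P t w -> (forall t', P t' w -> t <= t') -> eval q [:: w] (g t w).
Proof.
move=> /computable_negb[qP HqP] [qg Hqg].
exists (RComp qg [:: RMu qP; RProj 0]) => w t Pt least_t.
apply: (@evComp _ _ _ [:: t; w]); last exact: (Hqg [:: t; w]).
apply: evsCons; last by apply: evsCons (evsNil _); apply: (evProj 0 [:: w]).
apply: evMu; first by have := HqP [:: t; w] erefl; rewrite /arg /= Pt.
move=> t' lt_t't; exists 1; split => //; have := HqP [:: t'; w] erefl; rewrite /arg /=.
by case: (boolP (P t' w)) => // /least_t; rewrite leqNgt lt_t't.
Qed.

Definition listed_by p y n x t := (x < t) && (eval_fuel t p [:: x; y; n] != None).

Lemma listed_by_mono p y n x t t' : t <= t' -> listed_by p y n x t -> listed_by p y n x t'.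
Proof.
move=> le_tt' /andP[lt_xt]; rewrite /listed_by (leq_trans lt_xt le_tt').
by case E: eval_fuel => [v|] // _; rewrite (eval_fuel_mono le_tt' E).
Qed.

Lemma listed_by_lt p y n x t : listed_by p y n x t -> x < t.
Proof. by case/andP. Qed.

Lemma listed_by_eval p y n x t : listed_by p y n x t -> exists v, eval p [:: x; y; n] v.
Proof.
by case/andP => _; case E: eval_fuel => [v|] // _; exists v; apply: eval_fuel_sound E.
Qed.

Lemma eval_listed_by p y n x v : eval p [:: x; y; n] v -> exists t, listed_by p y n x t.
Proof.
move=> /eval_fuel_complete[t Ht]; exists (maxn t x.+1).
by rewrite /listed_by leq_max ltnSn orbT (eval_fuel_mono (leq_maxl _ _) Ht).
Qed.

Lemma computable_listed_by p (y n : nat -> nat) :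
  computable 1 (fun l => y (arg 0 l)) -> computable 1 (fun l => n (arg 0 l)) ->
  computable 3 (fun l => listed_by p (y (arg 2 l)) (n (arg 2 l)) (arg 0 l) (arg 1 l)).
Proof.
move=> Hy Hn; apply: computable_andb (computable_lt (computable_arg _ 0) (computable_arg _ 1)) _.
have Hsim : computable 3 (fun l =>
    clocked p [:: arg 1 l; arg 0 l; y (arg 2 l); n (arg 2 l)]).
  apply: (@computable_app 3 [:: arg 1; arg 0; fun l => y (arg 2 l); fun l => n (arg 2 l)]).
    exact: clocked_computable_all.
  case=> [|[|[|[|i]]]] //= _; try exact: computable_arg.
    exact: computable_comp1 Hy (computable_arg _ 2).
  exact: computable_comp1 Hn (computable_arg _ 2).
apply: computable_bool Hsim _ => l _.
by rewrite /clocked /=; case: eval_fuel.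
Qed.

(** * Short descriptions from a sparse upper semicomputable bound *)

(* On input [w = code (spair z y)] the decoder sets [n := size z - D] and outputs the
   element whose rank, in the enumeration of [{x | p halts on (x, y, n)}], is the index
   of [z] among the strings of its length. *)
Definition decoder_listed p D w := listed_by p (pair_snd w) (pair_len w - D).
Definition decoder_output p D t w := find_rank (decoder_listed p D w) (pair_index w) t.

Lemma decoder_program p D : exists T, forall w t,
  decoder_output p D t w < t -> (forall t', decoder_output p D t' w < t' -> t <= t') ->
  eval T [:: w] (decoder_output p D t w).
Proof.
have Hlisted : computable 3 (fun l => decoder_listed p D (arg 2 l) (arg 0 l) (arg 1 l)).
  apply: (@computable_listed_by p pair_snd (fun w => pair_len w - D)).
    exact: computable_pair_snd (computable_arg _ 0).
  exact: computable_sub (computable_pair_len (computable_arg _ 0)) (computable_const _ D).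
have Hout := computable_find_rank Hlisted (computable_pair_index (computable_arg 1 0)).
exact: eval_at_least (computable_lt Hout (computable_arg _ 0)) Hout.
Qed.

Section Bounds.
Variables (B : str -> str -> nat) (p : rec) (d : nat).
Hypothesis B_usc : forall x y k, B x y <= k <-> exists v, eval p [:: code x; code y; k] v.
Hypothesis B_sparse : forall y n (xs : seq str),
  uniq xs -> all (fun x => B x y <= n) xs -> size xs <= d * 2 ^ n.

Lemma num_listed_by_le y n t : num_listed (listed_by p (code y) n) t <= d * 2 ^ n.
Proof.
set S := listed_by p (code y) n.
have -> : num_listed S t = size [seq decode x | x <- iota 0 t & S x t].
  rewrite size_map size_filter -sum1_count big_mkcond /num_listed /index_iota subn0.
  by apply: eq_bigr => x _; case: (S x t).
apply: (@B_sparse y n [seq decode x | x <- iota 0 t & S x t]).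
  rewrite map_inj_uniq; last exact: can_inj decodeK.
  exact/filter_uniq/iota_uniq.
apply/allP => _ /mapP[x + ->]; rewrite mem_filter => /andP[/listed_by_eval[v Hv] _].
by apply/B_usc; exists v; rewrite decodeK.
Qed.

Lemma short_descriptions :
  exists T, forall x y, exists z, runs T (spair z y) x /\ size z = B x y + d.
Proof.
have [T HT] := decoder_program p d.
exists T => x y; set n := B x y; set S := listed_by p (code y) n.
have S_mono := @listed_by_mono p (code y) n; have S_lt := @listed_by_lt p (code y) n.
have [st S_st least_st] : exists2 st, S (code x) st & forall t, S (code x) t -> st <= t.
  have [v /eval_listed_by ex_st] : exists v, eval p [:: code x; code y; n] v by apply/B_usc.
  by case: (ex_minnP ex_st) => st; exists st.
have fresh_x : fresh S (code x) st.
  have st_gt0 : 0 < st := leq_ltn_trans (leq0n _) (S_lt _ _ S_st).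
  by rewrite /fresh S_st; apply/negP => /least_st; rewrite leqNgt ltn_predL st_gt0.
set i := rank S (code x) st.
have lt_i : i < 2 ^ (n + d).
  apply: leq_trans (rank_lt_num S_mono S_lt fresh_x) _.
  apply: leq_trans (num_listed_by_le y n st) _.
  by rewrite expnD mulnC leq_mul2l (ltnW (ltn_expl d (ltnSn 1))) orbT.
have [size_z index_z] := decode_index lt_i.
set z := decode _ in size_z index_z; exists z; split => //.
set w := code (spair z y).
have S_w : decoder_listed p d w = S.
  by rewrite /decoder_listed pair_snd_spair pair_len_spair size_z addnK.
have i_w : pair_index w = i by rewrite pair_index_spair size_z.
have out_w t : decoder_output p d t w = find_rank S i t by rewrite /decoder_output S_w i_w.
have found_st : decoder_output p d st w < st by rewrite out_w find_rank_lt.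
have ex_ts : exists t, decoder_output p d t w < t by exists st.
case: (ex_minnP ex_ts) => ts found_ts least_ts.
have [out_ts _] : find_rank S i ts = code x /\ ts = st.
  by apply: (find_rank_eq S_mono S_lt fresh_x); rewrite -out_w.
by rewrite /runs -out_ts -out_w; apply: HT.
Qed.
End Bounds.

Lemma CT_is_least U x y z : runs U (spair z y) x -> exists k, CT_is U x y k /\ k <= size z.
Proof.
move=> Uz; pose Q k := exists z, runs U (spair z y) x /\ size z = k.
have [k [[Qk k_least] _]] := Wf_nat.dec_inh_nat_subset_has_unique_least_element Q
  (fun k => Classical_Prop.classic (Q k)) (ex_intro _ (size z) (ex_intro _ z (conj Uz erefl))).
exists k; split; last by apply/leP/k_least; exists z.
by split => // z' Uz'; apply/leP/k_least; exists z'.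
Qed.

Theorem theorem5 (U : rec) (HU : optimal U) (B : str -> str -> nat) :
  upper_semicomputable B ->
  (exists c, forall x y, B x y <= size x + c) ->
  (exists d, forall (y : str) (n : nat) (xs : seq str),
      uniq xs -> all (fun x => B x y <= n) xs -> size xs <= d * 2 ^ n) ->
  (exists e, forall x y, B (spair x y) y <= B x y + e) ->
  (forall f : rec, exists cf, forall x y z, runs f x z -> B z y <= B x y + cf) ->
  exists c', forall x y, exists k,
    CT_is U x y k /\ B x y <= k + c' /\ k <= B x y + c'.
Proof.
move=> [p B_usc] [c B_le_size] [d B_sparse] [e B_spair] B_comp.
have [cU B_U] := B_comp U.
have [T T_short] := short_descriptions B_usc B_sparse.
have [cT T_U] := HU T.
exists (c + e + cU + d + cT) => x y.
have [z [Tz size_z]] := T_short x y.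
have [z' [Uz' size_z']] := T_U _ _ _ Tz.
have [k [CT_k le_k]] := CT_is_least Uz'.
exists k; split => //.
have [[z0 [Uz0 size_z0]] _] := CT_k.
have := B_U _ y _ Uz0; have := B_spair z0 y; have := B_le_size z0 y.
by split; lia.
Qed.
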